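(* The group $\mathrm{Isom}_e(K_0(\mathbb{P}_3))$ is isomorphic to $\mathbb{Z}^2$. It is generated by the operators $E\mapsto E\otimes\mathcal{O}(1)$ and $E\mapsto E\otimes(\mathcal{O}+\mathcal{O}_{\mathbb{P}_0})$.
   Context: Here $n=3$ in the following. $K_0(\mathbb{P}_n)$ is the Grothendieck group of coherent sheaves on the $n$-dimensional projective space $\mathbb{P}_n$ over a fixed ground field; it is a free $\mathbb{Z}$-module of rank $n+1$ with basis the classes of $\mathcal{O},\mathcal{O}(1),\dots,\mathcal{O}(n)$. A sheaf and its class are denoted by the same letter. The Euler form is the (nonsymmetric) nondegenerate bilinear form $\chi(E,F)=\sum_\nu(-1)^\nu\dim\mathrm{Ext}^\nu(E,F)$; it satisfies $\chi(\mathcal{O}(k),\mathcal{O}(m))=\binom{n+m-k}{n}$ for all $k,m\in\mathbb{Z}$, where $\binom{x}{n}=\frac{x(x-1)\cdots(x-n+1)}{n!}$. It is extended $\mathbb{R}$-bilinearly to $K_0(\mathbb{P}_n)\otimes\mathbb{R}$. $\mathrm{Isom}(K_0(\mathbb{P}_n))$ is the group of $\mathbb{Z}$-linear automorphisms of $K_0(\mathbb{P}_n)$ preserving $\chi$; $\mathrm{Isom}(K_0(\mathbb{P}_n)\otimes\mathbb{R})\subset GL(n+1,\mathbb{R})$ is the group of $\mathbb{R}$-linear automorphisms of $K_0(\mathbb{P}_n)\otimes\mathbb{R}$ preserving $\chi$, and $\mathrm{Isom}_e(K_0(\mathbb{P}_n)\otimes\mathbb{R})$ is its connected component of the identity. Regarding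 $\mathrm{Isom}(K_0(\mathbb{P}_n))$ as a subgroup of $\mathrm{Isom}(K_0(\mathbb{P}_n)\otimes\mathbb{R})$, one sets $\mathrm{Isom}_e(K_0(\mathbb{P}_n))=\mathrm{Isom}(K_0(\mathbb{P}_n))\cap \mathrm{Isom}_e(K_0(\mathbb{P}_n)\otimes\mathbb{R})$. The symbol $\otimes$ between classes denotes the commutative ring structure on $K_0(\mathbb{P}_n)$ induced by tensor product of locally free sheaves; it is the bilinear product with $\mathcal{O}(k)\otimes\mathcal{O}(m)=\mathcal{O}(k+m)$ for all $k,m\in\mathbb{Z}$. For $0\leqslant m\leqslant n$, $\mathcal{O}_{\mathbb{P}_m}$ is the class of the structure sheaf of an $m$-dimensional linear subspace $\mathbb{P}_m\subset\mathbb{P}_n$ (so $\mathcal{O}_{\mathbb{P}_n}=\mathcal{O}$); in the ring $K_0(\mathbb{P}_n)$ one has $\mathcal{O}_{\mathbb{P}_m}=(\mathcal{O}-\mathcal{O}(-1))^{n-m}$. *)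

(* Defs.v *)
From HB Require Import structures.
From mathcomp Require Import all_boot all_order all_algebra.
From mathcomp Require Import all_classical all_reals topology normedtype.
From mathcomp Require Import zify ring.

Set Implicit Arguments.
Unset Strict Implicit.
Unset Printing Implicit Defensive.

Import Order.TTheory GRing.Theory Num.Theory.
Import numFieldNormedType.Exports.

Local Open Scope classical_set_scope.
Local Open Scope ring_scope.

(* x (x - 1) ... (x - n + 1) / n!  for any x in Z; the division is exact. *)
Definition binz (x : int) (n : nat) : int :=
  ((\prod_(i < n) (x - i%:Z)) %/ (n`!)%:Z)%Z.

(* Coherent sheaves are not available, so K_0(P_n) is given by its standard
   description: a commutative ring (product = tensor product) with classes O(k) = [twist k],
   k in Z, additively free on O(0), ..., O(n), and with a biadditive Euler form
   taking the values binom(n + m - k, n) on the pairs (O(k), O(m)).  These data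
   determine the structure up to unique isomorphism.  The field [coord] only
   records the coordinates in the basis O(0), ..., O(n). *)
Record K0P (n : nat) := MkK0P {
  K0ring :> comNzRingType;
  twist : int -> K0ring;
  coord : K0ring -> 'cV[int]_n.+1;
  chi : K0ring -> K0ring -> int;
  twistM : forall k m : int, twist k * twist m = twist (k + m);
  twist_span : forall E : K0ring, E = \sum_(i < n.+1) twist i%:Z *~ coord E i 0;
  twist_free : forall c : 'cV[int]_n.+1,
    coord (\sum_(i < n.+1) twist i%:Z *~ c i 0) = c;
  chiDl : forall E1 E2 F : K0ring, chi (E1 + E2) F = chi E1 F + chi E2 F;
  chiDr : forall E F1 F2 : K0ring, chi E (F1 + F2) = chi E F1 + chi E F2;
  chi_twist : forall k m : int, chi (twist k) (twist m) = binz (n%:Z + m - k) n }.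

Arguments twist {n} K k : rename.

Section Isometries.
Variables (R : realType) (n : nat) (K : K0P n).

(* The class of the structure sheaf of P_m in P_n, for m <= n. *)
Definition O_lin (m : nat) : K := (twist K 0 - twist K (- 1)) ^+ (n - m).

(* Z-linear maps between Z-modules are additive maps. *)
Definition Isom : set (K -> K) :=
  [set f : K -> K | [/\ {morph f : E F / E + F}, bijective f &
               forall E F, chi (f E) (f F) = chi E F]].

(* K_0(P_n) (x) R is R^(n+1), with coordinates in the basis O(0), ..., O(n). *)
Definition chiR (u v : 'cV[R]_n.+1) : R :=
  \sum_(i < n.+1) \sum_(j < n.+1)
    u i 0 * v j 0 * (chi (twist K i%:Z) (twist K j%:Z))%:~R.

Definition IsomR : set 'M[R]_n.+1 :=
  [set g | g \in unitmx /\
           forall u v : 'cV[R]_n.+1, chiR (g *m u) (g *m v) = chiR u v].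

Definition IsomR_e : set 'M[R]_n.+1 := connected_component IsomR 1%:M.

(* The matrix of f (x) R in the basis O(0), ..., O(n), acting on columns. *)
Definition tensR (f : K -> K) : 'M[R]_n.+1 :=
  \matrix_(i, j) (coord (f (twist K j%:Z)) i 0)%:~R.

Definition Isom_e : set (K -> K) := Isom `&` [set f | IsomR_e (tensR f)].

End Isometries.

Arguments O_lin {n} K m.
Arguments Isom {n} K _.
Arguments IsomR R {n} K _.
Arguments IsomR_e R {n} K _.
Arguments Isom_e R {n} K _.

Section TransformationGroups.
Variable T : Type.

Definition transf_group (G : set (T -> T)) : Prop :=
  [/\ forall f, G f -> bijective f,
      G id,
      forall f g, G f -> G g -> G (f \o g)
    & forall f g, G f -> cancel f g -> cancel g f -> G g].

Definition generated (S : set (T -> T)) : set (T -> T) :=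
  smallest transf_group S.

Definition transf_isog (V : zmodType) (G : set (T -> T)) : Prop :=
  exists phi : V -> (T -> T),
    set_bij setT G phi /\ forall a b, phi (a + b) = phi a \o phi b.

End TransformationGroups.

(* Consistency of the description above: Z[t]/(t - 1)^4, with t = O(1), is a
   K0P 3.  An element is given by its coordinates in the basis (t - 1)^i. *)
Module Model.

Definition car : Type := (int * int * int * int)%type.
HB.instance Definition _ := GRing.Zmodule.on car.

Definition c0 (x : car) : int := x.1.1.1.
Definition c1 (x : car) : int := x.1.1.2.
Definition c2 (x : car) : int := x.1.2.
Definition c3 (x : car) : int := x.2.

Definition mul (x y : car) : car :=
  (c0 x * c0 y,
   c0 x * c1 y + c1 x * c0 y,
   c0 x * c2 y + c1 x * c1 y + c2 x * c0 y,
   c0 x * c3 y + c1 x * c2 y + c2 x * c1 y + c3 x * c0 y).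

Definition one : car := (1, 0, 0, 0).

Lemma carP (x y : car) :
  c0 x = c0 y -> c1 x = c1 y -> c2 x = c2 y -> c3 x = c3 y -> x = y.
Proof.
by case: x y => [[[? ?] ?] ?] [[[? ?] ?] ?]; rewrite /c0 /c1 /c2 /c3 /= => -> -> -> ->.
Qed.

Lemma c0D x y : c0 (x + y) = c0 x + c0 y. Proof. by []. Qed.
Lemma c1D x y : c1 (x + y) = c1 x + c1 y. Proof. by []. Qed.
Lemma c2D x y : c2 (x + y) = c2 x + c2 y. Proof. by []. Qed.
Lemma c3D x y : c3 (x + y) = c3 x + c3 y. Proof. by []. Qed.
Definition cD := (c0D, c1D, c2D, c3D).

Lemma mulA : associative mul.
Proof. by move=> x y z; apply: carP; rewrite /mul /c0 /c1 /c2 /c3 /=; ring. Qed.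
Lemma mulC : commutative mul.
Proof. by move=> x y; apply: carP; rewrite /mul /c0 /c1 /c2 /c3 /=; ring. Qed.
Lemma mul1 : left_id one mul.
Proof. by move=> x; apply: carP; rewrite /mul /one /c0 /c1 /c2 /c3 /=; ring. Qed.
Lemma mulD : left_distributive mul +%R.
Proof.
move=> x y z; apply: carP; rewrite cD [in LHS]/mul ![in RHS]/mul.
all: rewrite /c0 /c1 /c2 /c3 /=; ring.
Qed.
Lemma one0 : one != 0 :> car. Proof. by []. Qed.

HB.instance Definition _ :=
  GRing.Zmodule_isComNzRing.Build car mulA mulC mul1 mulD one0.

Definition tw (k : int) : car := (1, k, binz k 2, binz k 3).

Lemma binz2 k : 2 * binz k 2 = k * (k - 1).
Proof.
rewrite /binz !big_ord_recr big_ord0 /= mul1r subr0.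
suff [c ->] : exists c, k * (k - 1) = 2 * c by rewrite [X in (X %/ _)%Z]mulrC mulzK.
have := divz_eq k 2; have : (0 <= (k %% 2)%Z < 2)%R by rewrite modz_ge0 ?ltz_pmod.
move: (k %/ 2)%Z (k %% 2)%Z => q r hr ->.
have [->|->] : r = 0 \/ r = 1 by lia.
- by exists (q * (q * 2 - 1)); ring.
- by exists ((q * 2 + 1) * q); ring.
Qed.

Lemma binz3 k : 6 * binz k 3 = k * (k - 1) * (k - 2).
Proof.
rewrite /binz !big_ord_recr big_ord0 /= mul1r subr0.
suff [c ->] : exists c, k * (k - 1) * (k - 2) = 6 * c
  by rewrite [X in (X %/ _)%Z]mulrC mulzK.
have := divz_eq k 6; have : (0 <= (k %% 6)%Z < 6)%R by rewrite modz_ge0 ?ltz_pmod.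
move: (k %/ 6)%Z (k %% 6)%Z => q r hr ->.
have [|[|[|[|[|]]]]] : r = 0 \/ r = 1 \/ r = 2 \/ r = 3 \/ r = 4 \/ r = 5 by lia.
all: move=> ->.
- by exists (q * (q * 6 - 1) * (q * 6 - 2)); ring.
- by exists ((q * 6 + 1) * q * (q * 6 - 1)); ring.
- by exists ((q * 6 + 2) * (q * 6 + 1) * q); ring.
- by exists ((q * 2 + 1) * (q * 3 + 1) * (q * 6 + 1)); ring.
- by exists ((q * 3 + 2) * (q * 2 + 1) * (q * 6 + 2)); ring.
- by exists ((q * 6 + 5) * (q * 3 + 2) * (q * 2 + 1)); ring.
Qed.

Lemma twM k m : tw k * tw m = tw (k + m).
Proof.
have := (binz2 k, binz2 m, binz2 (k + m)); have := (binz3 k, binz3 m, binz3 (k + m)).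
move=> [[h1 h2] h3] [[e1 e2] e3].
rewrite -[LHS]/(mul _ _) /mul; apply: carP; rewrite /c0 /c1 /c2 /c3 /=.
- by rewrite mulr1.
- by rewrite mul1r mulr1 addrC.
- apply: (mulfI (_ : 2 != 0 :> int)) => //.
  rewrite e3; transitivity (2 * binz m 2 + 2 * (k * m) + 2 * binz k 2); first by ring.
  by rewrite e1 e2; ring.
- apply: (mulfI (_ : 6 != 0 :> int)) => //; rewrite h3.
  transitivity (6 * binz m 3 + 3 * k * (2 * binz m 2) + 3 * m * (2 * binz k 2)
                + 6 * binz k 3); first by ring.
  by rewrite e1 e2 h1 h2; ring.
Qed.

Definition euler (x y : car) : int :=
  c0 x * (c0 y + 3 * c1 y + 3 * c2 y + c3 y)
  - c1 x * (c0 y + 2 * c1 y + c2 y)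
  + c2 x * (c0 y + c1 y) - c3 x * c0 y.

Lemma euler_tw k m : euler (tw k) (tw m) = binz (3 + m - k) 3.
Proof.
have := (binz2 k, binz2 m); have := (binz3 k, binz3 m, binz3 (3 + m - k)).
move=> [[h1 h2] h3] [e1 e2].
apply: (mulfI (_ : 6 != 0 :> int)) => //; rewrite h3 /euler /c0 /c1 /c2 /c3 /=.
transitivity (6 + 18 * m + 9 * (2 * binz m 2) + 6 * binz m 3
  - k * (6 + 12 * m + 3 * (2 * binz m 2)) + 3 * (2 * binz k 2) * (1 + m)
  - 6 * binz k 3); first by ring.
by rewrite e1 e2 h1 h2; ring.
Qed.

Definition crd (x : car) : 'cV[int]_4 :=
  \col_i [:: c0 x - c1 x + c2 x - c3 x; c1 x - 2 * c2 x + 3 * c3 x;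
             c2 x - 3 * c3 x; c3 x]`_i.

Lemma scaleE (x : car) z : x *~ z = (c0 x * z, c1 x * z, c2 x * z, c3 x * z).
Proof.
have nE (y : car) n : y *+ n =
    (c0 y * n%:Z, c1 y * n%:Z, c2 y * n%:Z, c3 y * n%:Z).
  elim: n => [|n IH]; first by rewrite mulr0n !mulr0.
  by rewrite mulrS IH; apply: carP; rewrite cD /c0 /c1 /c2 /c3 /=; lia.
case: z => n; first exact: nE.
rewrite NegzE mulrNz -pmulrn nE.
by apply: carP; rewrite /c0 /c1 /c2 /c3 /=; lia.
Qed.

Lemma tw_sum (c : 'cV[int]_4) :
  \sum_(i < 4) tw i%:Z *~ c i 0 =
  (c 0 0 + c 1 0 + c 2%:R 0 + c 3%:R 0, c 1 0 + 2 * c 2%:R 0 + 3 * c 3%:R 0,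
   c 2%:R 0 + 3 * c 3%:R 0, c 3%:R 0).
Proof.
rewrite !big_ord_recl big_ord0 addr0 !scaleE.
rewrite (_ : lift ord0 ord0 = 1 :> 'I_4); last exact/val_inj.
rewrite (_ : lift ord0 (lift ord0 ord0) = 2%:R :> 'I_4); last exact/val_inj.
rewrite (_ : lift ord0 (lift ord0 (lift ord0 ord0)) = 3%:R :> 'I_4); last exact/val_inj.
have b (k p q : nat) : (p%:Z = binz k 2) -> (q%:Z = binz k 3) ->
  tw k = (1, k%:Z, p%:Z, q%:Z) by rewrite /tw => -> ->.
rewrite (b 0 0 0)%N ?(b 1 0 0)%N ?(b 2 1 0)%N ?(b 3 3 1)%N;
  try (by rewrite /binz !big_ord_recr big_ord0).
rewrite -[ord0 in c ord0]/(0 : 'I_4).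
by apply: carP; rewrite !cD /c0 /c1 /c2 /c3 /=; ring.
Qed.

Lemma tw_span x : x = \sum_(i < 4) tw i%:Z *~ crd x i 0.
Proof.
by rewrite tw_sum !mxE /=; apply: carP; rewrite /c0 /c1 /c2 /c3 /=; lia.
Qed.

Lemma tw_free (c : 'cV[int]_4) : crd (\sum_(i < 4) tw i%:Z *~ c i 0) = c.
Proof.
rewrite tw_sum; apply/colP => i; rewrite mxE /c0 /c1 /c2 /c3 /=.
have [|[|[|]]] : i = 0 \/ i = 1 \/ i = 2%:R \/ i = 3%:R.
- case: i => [[|[|[|[|//]]]] hi]; [left|right; left|right; right; left|do 3 right];
    exact/val_inj.
all: by move=> -> /=; lia.
Qed.

Lemma eulerDl x y z : euler (x + y) z = euler x z + euler y z.
Proof. by rewrite /euler !cD; ring. Qed.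

Lemma eulerDr x y z : euler x (y + z) = euler x y + euler x z.
Proof. by rewrite /euler !cD; ring. Qed.

Definition K0P3 : K0P 3 :=
  MkK0P twM tw_span tw_free eulerDl eulerDr euler_tw.

End Model.

(* Main.v *)
(** K_0(P_3) is Z[h]/(h^4) with h = O(1) - O. By Serre duality
    chi (E (x) O(4), F) = - chi (F, E), so a real isometry commutes with the
    product by O(4). The latter is unipotent, and the product by O(1) is a
    polynomial in it over Q; hence an isometry is K_0-linear, i.e. the product by
    a class c0 + c1 h + c2 h^2 + c3 h^3. Preserving chi means c0 = +-1 and, when
    c0 = 1, c2 = binom(c1, 2). The rank c0 is continuous, so it is 1 on the
    identity component; conversely c1 and c3 can be scaled to 0 along a path of
    isometries. The integral classes of this form are the
    O(k) (x) (O + m O_{P_0}), with k = c1 and m = c3 - binom(c1, 3). *)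

Require Import Defs.
From HB Require Import structures.
From mathcomp Require Import all_boot all_order all_algebra.
From mathcomp Require Import all_classical all_reals topology normedtype.
From mathcomp Require Import zify ring.

Set Implicit Arguments.
Unset Strict Implicit.
Unset Printing Implicit Defensive.

Import Order.TTheory GRing.Theory Num.Theory.
Import numFieldNormedType.Exports.

Local Open Scope classical_set_scope.
Local Open Scope ring_scope.

Local Notation coord := Defs.coord.

Lemma morphD_sumz (U V : zmodType) (f : U -> V) (n : nat) (u : 'I_n -> U)
    (c : 'I_n -> int) :
  {morph f : x y / x + y} ->
  f (\sum_(i < n) u i *~ c i) = \sum_(i < n) f (u i) *~ c i.
Proof.
move=> fD.
have f0 : f 0 = 0 by apply: (addrI (f 0)); rewrite -fD !addr0.
pose fA : {additive U -> V} := HB.pack f (GRing.isNmodMorphism.Build U V f (f0, fD)).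
rewrite -[f]/(fA : U -> V) raddf_sum.
by apply: eq_bigr => i _; rewrite raddfMz.
Qed.

Lemma prodB_fact (n : nat) : \prod_(k < n) (n%:Z - k%:Z) = n`!%:Z.
Proof.
elim: n => [|n IH]; first by rewrite big_ord0.
rewrite big_ord_recl subr0 factS PoszM -IH; congr (_ * _).
by apply: eq_bigr => k _; rewrite /= /bump; lia.
Qed.

Section TwistBasis.
Variables (n : nat) (K : K0P n).
Implicit Types E F : K.

Lemma twist0 : twist K 0 = 1.
Proof.
rewrite -[LHS]mulr1 [X in _ * X]twist_span mulr_sumr [RHS]twist_span.
by apply: eq_bigr => i _; rewrite mulrzAr twistM add0r.
Qed.

Lemma twistX (i : nat) : twist K i = twist K 1 ^+ i.
Proof.
elim: i => [|i IH]; first by rewrite twist0.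
by rewrite exprS -IH twistM; congr twist; lia.
Qed.

Lemma coordD : {morph @coord n K : E F / E + F}.
Proof.
move=> E F; rewrite -[RHS](@twist_free n K); congr coord.
rewrite {1}(twist_span E) {1}(twist_span F) -big_split.
by apply: eq_bigr => i _; rewrite mxE mulrzDr.
Qed.

Lemma coord_inj : injective (@coord n K).
Proof. by move=> E F eqEF; rewrite [E]twist_span [F]twist_span eqEF. Qed.

Lemma coord_twist (i : 'I_n.+1) : coord (twist K i) = delta_mx i 0.
Proof.
rewrite -[RHS](@twist_free n K); congr coord.
rewrite (bigD1 i) //= mxE !eqxx mulr1z big1 ?addr0 // => j /negPf ji.
by rewrite mxE ji mulr0z.
Qed.

Lemma chi_coordr E F : chi E F = \sum_(j < n.+1) chi E (twist K j) * coord F j 0.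
Proof.
rewrite [in LHS](twist_span F) morphD_sumz; last exact: chiDr.
by apply: eq_bigr => j _; rewrite -mulrzr intz.
Qed.

Lemma chi_coordl E F : chi E F = \sum_(i < n.+1) chi (twist K i) F * coord E i 0.
Proof.
rewrite [in LHS](twist_span E) (@morphD_sumz _ _ (fun E => chi E F)) => [|E1 E2].
  by apply: eq_bigr => j _; rewrite -mulrzr intz.
exact: chiDl.
Qed.

Definition gram : 'M[int]_n.+1 := \matrix_(i, j) chi (twist K i) (twist K j).

Lemma det_gram : \det gram = 1.
Proof.
rewrite -det_tr det_trig => [|]; last first.
  apply/is_trig_mxP => i j ij; rewrite !mxE chi_twist /binz.
  have kn : (n + i - j < n)%N by have := ltn_ord j; lia.
  rewrite (bigD1 (Ordinal kn)) //= (_ : _ - (n + i - j)%N%:Z = 0) ?mul0r ?div0z //.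
  by have := ltn_ord j; lia.
apply: big1 => i _; rewrite !mxE chi_twist /binz addrK.
by rewrite prodB_fact divzz; case: n`! (fact_gt0 n).
Qed.

Lemma chi_twist_inj E F :
  (forall i : 'I_n.+1, chi (twist K i) E = chi (twist K i) F) -> E = F.
Proof.
move=> eq_chi; apply: coord_inj.
have gu : gram \in unitmx by rewrite unitmxE det_gram unitr1.
apply: (can_inj (mulKmx gu)); apply/colP => i; rewrite !mxE.
have := eq_chi i; rewrite !chi_coordr => e.
by under eq_bigr => j _ do rewrite mxE; under [RHS]eq_bigr => j _ do rewrite mxE.
Qed.

End TwistBasis.

Section Uniqueness.
Variable n : nat.

Definition K0P_iso (K K' : K0P n) (E : K) : K' :=
  \sum_(i < n.+1) twist K' i *~ coord E i 0.

Lemma coord_iso (K K' : K0P n) (E : K) : coord (K0P_iso K' E) = coord E.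
Proof. exact: twist_free. Qed.

Lemma isoK (K K' : K0P n) : cancel (@K0P_iso K K') (@K0P_iso K' K).
Proof. by move=> E; apply: coord_inj; rewrite !coord_iso. Qed.

Lemma iso_inj (K K' : K0P n) : injective (@K0P_iso K K').
Proof. exact: can_inj (@isoK K K'). Qed.

Variables K K' : K0P n.
Local Notation Phi := (@K0P_iso K K').

Lemma isoD : {morph Phi : E F / E + F}.
Proof. by move=> E F; apply: coord_inj; rewrite coordD !coord_iso coordD. Qed.

Lemma iso0 : Phi 0 = 0.
Proof. by apply: (addrI (Phi 0)); rewrite -isoD !addr0. Qed.

HB.instance Definition _ := GRing.isNmodMorphism.Build K K' Phi (iso0, isoD).

Lemma iso_twist_ord (i : 'I_n.+1) : Phi (twist K i) = twist K' i.
Proof. by apply: coord_inj; rewrite coord_iso !coord_twist. Qed.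

Lemma chi_iso E F : chi (Phi E) (Phi F) = chi E F.
Proof.
rewrite chi_coordl [RHS]chi_coordl; apply: eq_bigr => i _; rewrite coord_iso.
congr (_ * _); rewrite chi_coordr [RHS]chi_coordr; apply: eq_bigr => j _.
by rewrite coord_iso !chi_twist.
Qed.

Lemma iso_twist k : Phi (twist K k) = twist K' k.
Proof.
apply: chi_twist_inj => i.
by rewrite -iso_twist_ord chi_iso iso_twist_ord !chi_twist.
Qed.

Lemma isoM : {morph Phi : E F / E * F}.
Proof.
move=> E F; rewrite (twist_span E) mulr_suml !raddf_sum mulr_suml.
apply: eq_bigr => i _; rewrite mulrzAl !raddfMz /= mulrzAl; congr (_ *~ _).
rewrite (twist_span F) mulr_sumr !raddf_sum mulr_sumr.
apply: eq_bigr => j _; rewrite mulrzAr !raddfMz /= mulrzAr twistM.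
by rewrite !iso_twist twistM.
Qed.

Lemma iso1 : Phi 1 = 1.
Proof. by rewrite -!twist0 iso_twist. Qed.

HB.instance Definition _ :=
  GRing.isMonoidMorphism.Build K K' Phi (iso1, isoM).

End Uniqueness.

Section RealMatrices.
Variables (R : realType) (n : nat) (K : K0P n).

Lemma tensR_comp (f g : K -> K) : {morph f : E F / E + F} ->
  tensR R (f \o g) = tensR R f *m tensR R g.
Proof.
move=> fD; apply/matrixP => i j; rewrite !mxE /=.
rewrite {1}(twist_span (g (twist K j))) (morphD_sumz _ _ fD).
rewrite (morphD_sumz _ _ (@coordD n K)) summxE rmorph_sum.
apply: eq_bigr => k _; rewrite !mxE -intrM /=; congr (_%:~R).
by rewrite -scaler_int mxE intz mulrC.
Qed.

Lemma tensR_inj (f g : K -> K) :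
  {morph f : E F / E + F} -> {morph g : E F / E + F} ->
  tensR R f = tensR R g -> f =1 g.
Proof.
move=> fD gD fg E; rewrite (twist_span E) (morphD_sumz _ _ fD) (morphD_sumz _ _ gD).
apply: eq_bigr => j _; congr (_ *~ _); apply: coord_inj; apply/colP => i.
by have /matrixP/(_ i j) := fg; rewrite !mxE => /intr_inj.
Qed.

Definition mulmat (a : K) : 'M[R]_n.+1 := tensR R (fun E : K => E * a).

Lemma mulmatB : {morph mulmat : a b / a - b}.
Proof.
move=> a b; apply/matrixP => i j; rewrite !mxE mulrBr -intrB; congr (_%:~R).
apply/eqP; rewrite eq_sym subr_eq; apply/eqP.
by rewrite -{1}(subrK (twist K j * b) (twist K j * a)) coordD mxE.
Qed.

Lemma mulmatM : {morph mulmat : a b / a * b}.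
Proof.
move=> a b; rewrite -[RHS]tensR_comp => [|E F]; last exact: mulrDl.
by congr tensR; apply/funext => E /=; rewrite -mulrA [b * a]mulrC.
Qed.

Lemma mulmat1 : mulmat 1 = 1.
Proof. 
by apply/matrixP => i j; rewrite !mxE mulr1 coord_twist mxE eqxx andbT; case: eqP.
 Qed.

HB.instance Definition _ :=
  GRing.isZmodMorphism.Build K 'M[R]_n.+1 mulmat mulmatB.
HB.instance Definition _ :=
  GRing.isMonoidMorphism.Build K 'M[R]_n.+1 mulmat (mulmat1, mulmatM).

Definition gramR : 'M[R]_n.+1 := map_mx intr (gram K).

Lemma gramR_unit : gramR \in unitmx.
Proof. by rewrite unitmxE det_map_mx det_gram rmorph1 unitr1. Qed.

Lemma chiRE (u v : 'cV[R]_n.+1) : chiR K u v = (u^T *m gramR *m v) 0 0.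
Proof.
rewrite mxE /chiR exchange_big; apply: eq_bigr => j _.
rewrite mxE mulr_suml; apply: eq_bigr => i _.
by rewrite !mxE -!mulrA [v j 0 * _]mulrC.
Qed.

Lemma IsomRP (g : 'M[R]_n.+1) :
  IsomR R K g <-> g \in unitmx /\ g^T *m gramR *m g = gramR.
Proof.
split=> -[gu giso]; split=> //; last first.
  by move=> u v; rewrite !chiRE trmx_mul -!mulmxA [g^T *m _]mulmxA
    [_ *m (g *m v)]mulmxA giso.
apply/matrixP => i j.
have entry (M : 'M[R]_n.+1) : M i j =
    ((delta_mx i 0 : 'cV_n.+1)^T *m M *m (delta_mx j 0 : 'cV_n.+1)) 0 0.
  by rewrite trmx_delta -rowE -colE !mxE.
have := giso (delta_mx i 0) (delta_mx j 0); rewrite !chiRE (entry gramR) => <-.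
by rewrite trmx_mul !mulmxA entry !mulmxA.
Qed.

Lemma gramR_mulmat a i j :
  (gramR *m mulmat a) i j = (chi (twist K i) (twist K j * a))%:~R.
Proof.
rewrite mxE chi_coordr rmorph_sum; apply: eq_bigr => k _.
by rewrite !mxE -intrM.
Qed.

Lemma tr_mulmat_gramR a i j :
  ((mulmat a)^T *m gramR) i j = (chi (twist K i * a) (twist K j))%:~R.
Proof.
rewrite mxE chi_coordl rmorph_sum; apply: eq_bigr => k _.
by rewrite !mxE mulrC -intrM.
Qed.

End RealMatrices.

Section K0PThree.
Variable K : K0P 3.
Implicit Types E F : K.

(* The class c0 + c1 h + c2 h^2 + c3 h^3, where h = O(1) - O. *)
Definition elt (c0 c1 c2 c3 : int) : K :=
  @K0P_iso 3 Model.K0P3 K (c0, c1, c2, c3).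

Lemma elt_surj E : exists c0 c1 c2 c3, E = elt c0 c1 c2 c3.
Proof.
have [x ->] : exists x : Model.K0P3, E = K0P_iso K x.
  by exists (K0P_iso Model.K0P3 E); rewrite isoK.
by case: x => [[[c0 c1] c2] c3]; exists c0, c1, c2, c3.
Qed.

Lemma elt_inj a0 a1 a2 a3 b0 b1 b2 b3 :
  elt a0 a1 a2 a3 = elt b0 b1 b2 b3 -> [/\ a0 = b0, a1 = b1, a2 = b2 & a3 = b3].
Proof. by move/iso_inj => [-> -> -> ->]. Qed.

Lemma eltD a0 a1 a2 a3 b0 b1 b2 b3 :
  elt a0 a1 a2 a3 + elt b0 b1 b2 b3 = elt (a0 + b0) (a1 + b1) (a2 + b2) (a3 + b3).
Proof. by rewrite /elt -isoD. Qed.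

Lemma eltN a0 a1 a2 a3 : - elt a0 a1 a2 a3 = elt (- a0) (- a1) (- a2) (- a3).
Proof. by rewrite /elt -rmorphN. Qed.

Lemma eltM a0 a1 a2 a3 b0 b1 b2 b3 :
  elt a0 a1 a2 a3 * elt b0 b1 b2 b3 =
  elt (a0 * b0) (a0 * b1 + a1 * b0) (a0 * b2 + a1 * b1 + a2 * b0)
      (a0 * b3 + a1 * b2 + a2 * b1 + a3 * b0).
Proof. by rewrite /elt -isoM. Qed.

Lemma elt0 : elt 0 0 0 0 = 0.
Proof. exact: iso0. Qed.

Lemma elt1 : elt 1 0 0 0 = 1.
Proof. exact: iso1. Qed.

Lemma eltMz a0 a1 a2 a3 z :
  elt a0 a1 a2 a3 *~ z = elt (a0 * z) (a1 * z) (a2 * z) (a3 * z).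
Proof. by rewrite /elt -raddfMz; congr K0P_iso; exact: Model.scaleE. Qed.

Lemma eltMn a0 a1 a2 a3 (n : nat) :
  elt a0 a1 a2 a3 *+ n = elt (a0 * n) (a1 * n) (a2 * n) (a3 * n).
Proof. by rewrite pmulrn eltMz. Qed.

Lemma twist_elt k : twist K k = elt 1 k (binz k 2) (binz k 3).
Proof. by rewrite -(iso_twist Model.K0P3). Qed.

Lemma chi_elt a0 a1 a2 a3 b0 b1 b2 b3 :
  chi (elt a0 a1 a2 a3) (elt b0 b1 b2 b3) =
  a0 * (b0 + 3 * b1 + 3 * b2 + b3) - a1 * (b0 + 2 * b1 + b2)
  + a2 * (b0 + b1) - a3 * b0.
Proof. by rewrite /elt chi_iso. Qed.

Lemma sum_coord_elt c0 c1 c2 c3 : \sum_(i < 4) coord (elt c0 c1 c2 c3) i 0 = c0.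
Proof.
rewrite coord_iso /= !big_ord_recl big_ord0 !mxE /=.
by rewrite /Model.c0 /Model.c1 /Model.c2 /Model.c3 /=; ring.
Qed.

Lemma twist_eq k b2 b3 : 2 * b2 = k * (k - 1) -> 6 * b3 = k * (k - 1) * (k - 2) ->
  twist K k = elt 1 k b2 b3.
Proof.
move=> h2 h3; rewrite twist_elt; congr elt.
- by apply: (mulfI (_ : 2 != 0 :> int)); rewrite ?h2 ?Model.binz2.
- by apply: (mulfI (_ : 6 != 0 :> int)); rewrite ?h3 ?Model.binz3.
Qed.

Definition hclass : K := twist K 1 - 1.

Lemma hclass_elt : hclass = elt 0 1 0 0.
Proof. by rewrite /hclass (@twist_eq 1 0 0) // -elt1 eltN eltD. Qed.

Lemma hclass2_elt : hclass ^+ 2 = elt 0 0 1 0.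
Proof. by rewrite expr2 hclass_elt eltM. Qed.

Lemma hclass3_elt : hclass ^+ 3 = elt 0 0 0 1.
Proof. by rewrite exprS hclass2_elt hclass_elt eltM. Qed.

Lemma hclass_nilp : hclass ^+ 4 = 0.
Proof. by rewrite exprS hclass3_elt hclass_elt eltM -elt0. Qed.

Lemma O_point : O_lin K 0 = hclass ^+ 3.
Proof.
rewrite hclass3_elt /O_lin twist0 -elt1 (@twist_eq (- 1) 1 (- 1)) // eltN eltD.
by rewrite !exprS expr0 mulr1 !eltM.
Qed.

(* As h^4 = 0, h = (t^4 - 1) / 4 + ... is a polynomial in t^4 - 1 over Q. *)
Lemma hclass_128 : hclass *+ 128 =
  (twist K 4 - 1) *+ 32 - (twist K 4 - 1) ^+ 2 *+ 12 + (twist K 4 - 1) ^+ 3 *+ 7.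
Proof.
rewrite (@twist_eq 4 6 4) // -elt1 hclass_elt !exprS expr0 !mulr1.
by rewrite !(eltN, eltD, eltM, eltMn).
Qed.

Lemma elt_hclass c0 c1 c2 c3 :
  elt c0 c1 c2 c3 = 1 *~ c0 + hclass *~ c1 + hclass ^+ 2 *~ c2 + hclass ^+ 3 *~ c3.
Proof.
rewrite hclass2_elt hclass3_elt hclass_elt -elt1 !eltMz !eltD.
by congr elt; ring.
Qed.

Lemma chi_hclass E F :
  chi (E * hclass) F = chi E (F * (- hclass + hclass ^+ 2 - hclass ^+ 3)).
Proof.
have [? [? [? [? ->]]]] := elt_surj E; have [? [? [? [? ->]]]] := elt_surj F.
by rewrite hclass2_elt hclass3_elt hclass_elt !(eltN, eltD, eltM) !chi_elt; ring.
Qed.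

Lemma chi_hclass2 E F :
  chi (E * hclass ^+ 2) F = chi E (F * (hclass ^+ 2 - hclass ^+ 3 *+ 2)).
Proof.
have [? [? [? [? ->]]]] := elt_surj E; have [? [? [? [? ->]]]] := elt_surj F.
by rewrite hclass2_elt hclass3_elt !(eltMn, eltN, eltD, eltM) !chi_elt; ring.
Qed.

Lemma chi_hclass3 E F : chi (E * hclass ^+ 3) F = chi E (F * - hclass ^+ 3).
Proof.
have [? [? [? [? ->]]]] := elt_surj E; have [? [? [? [? ->]]]] := elt_surj F.
by rewrite hclass3_elt !(eltN, eltM) !chi_elt; ring.
Qed.

Lemma chi_twist_point k m : chi (twist K k) (twist K m * hclass ^+ 3) = 1.
Proof. by rewrite hclass3_elt !twist_elt eltM chi_elt; ring. Qed.

Lemma chi_serre E F : chi (E * twist K 4) F = - chi F E.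
Proof.
have [? [? [? [? ->]]]] := elt_surj E; have [? [? [? [? ->]]]] := elt_surj F.
by rewrite (@twist_eq 4 6 4) // eltM !chi_elt; ring.
Qed.

Lemma chi_mul_elt c1 c2 c3 E F : 2 * c2 = c1 * (c1 - 1) ->
  chi (E * elt 1 c1 c2 c3) (F * elt 1 c1 c2 c3) = chi E F.
Proof.
have [e0 [e1 [e2 [e3 ->]]]] := elt_surj E; have [f0 [f1 [f2 [f3 ->]]]] := elt_surj F.
move=> c2E; rewrite !eltM !chi_elt.
apply/eqP; rewrite -subr_eq0; apply/eqP.
transitivity ((2 * c2 - c1 * (c1 - 1)) * (2 * e0 * f0 + e0 * f1 - e1 * f0)).
  by ring.
by rewrite c2E subrr mul0r.
Qed.

End K0PThree.

(* Inverse of a truncated binomial series (1 + N)^p, by the substitution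
   N |-> (1 + N)^-1 - 1 that realizes the duality O(1) |-> O(-1). *)
Lemma nilpotent4_inv (R : realType) (n : nat) (N : 'M[R]_n.+1) (p q : R)
    (c := (p ^+ 2 - p) / 2) : N ^+ 4 = 0 ->
  (1 + p *: (- N + N ^+ 2 - N ^+ 3) + c *: (N ^+ 2 - N ^+ 3 *+ 2) + q *: - N ^+ 3)
  * (1 + p *: N + c *: N ^+ 2 + q *: N ^+ 3) = 1.
Proof.
move=> N4.
pose Pl : {poly R} := 1 + p%:P * (- 'X + 'X ^+ 2 - 'X ^+ 3)
  + c%:P * ('X ^+ 2 - 'X ^+ 3 *+ 2) + q%:P * - 'X ^+ 3.
pose Pr : {poly R} := 1 + p%:P * 'X + c%:P * 'X ^+ 2 + q%:P * 'X ^+ 3.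
have cE : c%:P + c%:P = p%:P ^+ 2 - p%:P :> {poly R}.
  by rewrite -polyCD -rmorphXn -rmorphB /= /c; congr polyC; field.
have PlPr : exists Q, Pl * Pr = 1 + Q * 'X ^+ 4.
  exists ((p%:P + c%:P) * c%:P - p%:P * q%:P - (p%:P + 2 * c%:P + q%:P) * p%:P
    + ((p%:P + c%:P) * q%:P - (p%:P + 2 * c%:P + q%:P) * c%:P) * 'X
    - (p%:P + 2 * c%:P + q%:P) * q%:P * 'X ^+ 2).
  transitivity (1 + (c%:P + c%:P - (p%:P ^+ 2 - p%:P)) * ('X ^+ 2 - 'X ^+ 3)
    + ((p%:P + c%:P) * c%:P - p%:P * q%:P - (p%:P + 2 * c%:P + q%:P) * p%:P
    + ((p%:P + c%:P) * q%:P - (p%:P + 2 * c%:P + q%:P) * c%:P) * 'X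
    - (p%:P + 2 * c%:P + q%:P) * q%:P * 'X ^+ 2) * 'X ^+ 4).
    by rewrite /Pl /Pr; ring.
  by rewrite cE subrr mul0r addr0.
have [Q PlPrE] := PlPr.
transitivity (horner_mx N Pl * horner_mx N Pr); last first.
  by rewrite -rmorphM PlPrE rmorphD rmorph1 rmorphM rmorphXn /= horner_mx_X N4
    mulr0 addr0.
rewrite /Pl /Pr !mul_polyC !rmorphD rmorph1 /= !horner_mxZ.
by rewrite !(rmorphD, rmorphN, rmorphMn, rmorphXn) /= !horner_mx_X.
Qed.

Section RealIsometries.
Variables (R : realType) (K : K0P 3).
Local Notation N := (mulmat R (hclass K)).
Local Notation G := (gramR R K).

Lemma gramR_serre : G^T *m mulmat R (twist K 4) = - G.
Proof.
apply: trmx_inj; rewrite trmx_mul trmxK; apply/matrixP => i j.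
by rewrite tr_mulmat_gramR chi_serre rmorphN !mxE.
Qed.

(* By Serre duality, the isometry g also preserves the transpose of the Gram
   matrix, hence commutes with the canonical operator. *)
Lemma IsomR_comm_twist4 g : IsomR R K g -> GRing.comm g (mulmat R (twist K 4)).
Proof.
move=> /IsomRP[gu giso]; have Gu := gramR_unit R K.
have gGu : g^T *m G^T \in unitmx by rewrite unitmx_mul !unitmx_tr gu.
apply: (can_inj (mulKmx gGu)).
have gisoT : g^T *m G^T *m g = G^T by rewrite -[in RHS]giso !trmx_mul trmxK mulmxA.
rewrite /GRing.mul /= [LHS]mulmxA gisoT gramR_serre.
by rewrite mulmxA -[_ *m mulmat R _]mulmxA gramR_serre mulmxN mulNmx giso.
Qed.

Lemma IsomR_comm_hclass g : IsomR R K g -> GRing.comm g N.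
Proof.
move=> /IsomR_comm_twist4 gT.
have gm : GRing.comm g (mulmat R (twist K 4 - 1)).
  by rewrite rmorphB rmorph1; apply: commrB => //; exact: commr1.
have -> : N = (128%:R)^-1 *: mulmat R (hclass K *+ 128).
  by rewrite rmorphMn /= -[N *+ 128]scaler_nat scalerA mulVf ?scale1r // pnatr_eq0.
rewrite hclass_128 rmorphD rmorphB !rmorphMn !rmorphXn /=.
rewrite /GRing.comm -scalerAl -scalerAr; congr (_ *: _).
apply: commrD; first apply: commrB; apply: commrMn => //; exact: commrX.
Qed.

Lemma IsomR_comm_twist1 g : IsomR R K g -> GRing.comm g (mulmat R (twist K 1)).
Proof.
move=> /IsomR_comm_hclass gN.
rewrite -(subrK 1 (twist K 1)) rmorphD rmorph1; apply: commrD => //.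
exact: commr1.
Qed.

Lemma gramR_point : G *m mulmat R (hclass K ^+ 3) = const_mx 1.
Proof. by apply/matrixP => i j; rewrite gramR_mulmat chi_twist_point mxE. Qed.

Definition sheaf_rank (g : 'M[R]_4) : R := \sum_(i < 4) g i 0.

(* For the class x of a point, chi (-, x) is the rank and E x = (rank E) x. As g
   commutes with x, rank (g O)^2 = chi (g O, g x) = chi (O, x) = 1. *)
Lemma IsomR_rank g : IsomR R K g -> sheaf_rank g ^+ 2 = 1.
Proof.
move=> gI; have [_ giso] := (IsomRP K g).1 gI.
have gX : g *m mulmat R (hclass K ^+ 3) = mulmat R (hclass K ^+ 3) *m g.
  by rewrite rmorphXn; exact: commrX (IsomR_comm_hclass gI).
have : (g^T *m (const_mx 1 *m g)) 0 0 = (const_mx 1 : 'M[R]_4) 0 0.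
  by rewrite -gramR_point -[in RHS]giso -!mulmxA gX.
rewrite !mxE => <-; rewrite expr2 /sheaf_rank mulr_suml.
apply: eq_bigr => i _; rewrite !mxE; congr (_ * _).
by apply: eq_bigr => j _; rewrite mxE mul1r.
Qed.

Lemma sheaf_rank_continuous : continuous sheaf_rank.
Proof.
have -> : sheaf_rank = \sum_(i < 4) (fun g : 'M[R]_4 => g i 0).
  by apply/funext => g; rewrite fct_sumE.
apply: (big_ind (fun f : 'M[R]_4 -> R => continuous f)) => [|f f' cf cf'|i _].
- by move=> g; exact: (@cst_continuous _ _ (0 : R)).
- by move=> g; apply: continuousD; [exact: cf | exact: cf'].
- exact: coord_continuous.
Qed.

Lemma IsomR_e_rank g : IsomR_e R K g -> sheaf_rank g = 1.
Proof.
move=> ge; have gI := connected_component_sub ge.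
have rank1 : sheaf_rank 1%:M = 1.
  by rewrite /sheaf_rank !big_ord_recl big_ord0 !mxE /= !addr0.
have I1 : IsomR R K 1%:M by split=> [|u v]; rewrite ?unitmx1 ?mul1mx.
have /connected_intervalP itv : connected (sheaf_rank @` IsomR_e R K).
  apply: connected_continuous_connected; first exact: component_connected.
  exact/continuous_subspaceT/sheaf_rank_continuous.
have /orP[/eqP //|/eqP rN1] : (sheaf_rank g == 1) || (sheaf_rank g == - 1).
  by rewrite -eqf_sqr expr1n IsomR_rank.
have [|||f fe f0] := itv (-1) 1 _ _ 0.
- by exists g.
- by exists 1%:M => //; exact: connected_component_refl.
- by rewrite oppr_le0 ler01.
have := IsomR_rank (connected_component_sub fe).
by rewrite f0 expr0n /= => /eqP; rewrite eq_sym oner_eq0.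
Qed.

(* Multiplication by O(p) + (q - binom(p, 3)) h^3 for real p; isometry forces the
   coefficient of h^2 to be binom(p, 2). *)
Definition path_mx (p q : R) : 'M[R]_4 :=
  1 + p *: N + ((p ^+ 2 - p) / 2) *: N ^+ 2 + q *: N ^+ 3.

Lemma mulmat_nilp : N ^+ 4 = 0.
Proof. by rewrite -rmorphXn hclass_nilp rmorph0. Qed.

Definition path_mx_dual (p q : R) : 'M[R]_4 :=
  1 + p *: (- N + N ^+ 2 - N ^+ 3)
  + ((p ^+ 2 - p) / 2) *: (N ^+ 2 - N ^+ 3 *+ 2) + q *: - N ^+ 3.

Lemma path_mx_inv p q : path_mx_dual p q * path_mx p q = 1.
Proof. exact: nilpotent4_inv mulmat_nilp. Qed.

Lemma tr_hclass_gramR : N^T *m G = G *m (- N + N ^+ 2 - N ^+ 3).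
Proof.
apply/matrixP => i j; rewrite tr_mulmat_gramR chi_hclass -gramR_mulmat.
by rewrite !(rmorphB, rmorphD, rmorphN, rmorphXn).
Qed.

Lemma tr_hclass2_gramR : (N ^+ 2)^T *m G = G *m (N ^+ 2 - N ^+ 3 *+ 2).
Proof.
apply/matrixP => i j; rewrite -rmorphXn /= tr_mulmat_gramR chi_hclass2 -gramR_mulmat.
by rewrite !(rmorphB, rmorphMn, rmorphXn).
Qed.

Lemma tr_hclass3_gramR : (N ^+ 3)^T *m G = G *m (- N ^+ 3).
Proof.
apply/matrixP => i j; rewrite -rmorphXn /= tr_mulmat_gramR chi_hclass3 -gramR_mulmat.
by rewrite !(rmorphN, rmorphXn).
Qed.

Lemma path_mx_IsomR p q : IsomR R K (path_mx p q).
Proof.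
have inv := path_mx_inv p q; apply/IsomRP; split; first by case/mulmx1_unit: inv.
have trA : (path_mx p q)^T *m G = G *m path_mx_dual p q.
  have -> : (path_mx p q)^T = 1 + p *: N^T + ((p ^+ 2 - p) / 2) *: (N ^+ 2)^T
      + q *: (N ^+ 3)^T by rewrite !linearD !linearZ /= trmx1.
  rewrite !mulmxDl mul1mx -!scalemxAl /path_mx_dual.
  rewrite tr_hclass_gramR tr_hclass2_gramR tr_hclass3_gramR.
  by rewrite [RHS]mulmxDr [_ *m (1 + _ + _)]mulmxDr [_ *m (1 + _)]mulmxDr mulmx1
    -!scalemxAr.
by rewrite trA -mulmxA [_ *m path_mx p q]inv mulmx1.
Qed.

Lemma path_mx_continuous p q : continuous (fun t : R => path_mx (t * p) (t * q)).
Proof.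
move=> t; have cM (r : R) : s * r @[s --> t] --> t * r.
  by apply: cvgM; [exact: cvg_id | exact: cvg_cst].
apply: cvgD; last by apply: cvgZr_tmp.
apply: cvgD; first by apply: cvgD; [exact: cvg_cst | exact: cvgZr_tmp].
apply: cvgZr_tmp; apply: cvgM; last exact: cvg_cst.
by apply: cvgB => //; rewrite expr2; apply: cvgM.
Qed.

Lemma path_mx_IsomR_e p q : IsomR_e R K (path_mx p q).
Proof.
pose f (t : R) := path_mx (t * p) (t * q).
apply: (@connected_component_max _ _ (range f)).
- by exists 0 => //; rewrite /f /path_mx !mul0r expr0n subrr mul0r !scale0r !addr0.
- by move=> _ [t _ <-]; exact: path_mx_IsomR.
- apply: connected_continuous_connected.
    by apply/connected_intervalP => x y _ _ z _.
  exact/continuous_subspaceT/path_mx_continuous.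
- by exists 1 => //; rewrite /f !mul1r.
Qed.

Lemma mulmat_elt_IsomR_e c1 c2 c3 : 2 * c2 = c1 * (c1 - 1) ->
  IsomR_e R K (mulmat R (elt K 1 c1 c2 c3)).
Proof.
move=> c2E; suff -> : mulmat R (elt K 1 c1 c2 c3) = path_mx c1%:~R c3%:~R.
  exact: path_mx_IsomR_e.
rewrite elt_hclass mulr1z 3!rmorphD rmorph1 !rmorphMz !rmorphXn /path_mx /=.
rewrite -[N *~ c1]scaler_int -[N ^+ 2 *~ c2]scaler_int -[N ^+ 3 *~ c3]scaler_int.
congr (_ + _ *: _ + _); have n2 : 2 != 0 :> R by rewrite pnatr_eq0.
by apply: (mulfI n2); rewrite mulrCA divff // mulr1 -[2]/(2%:~R) -intrM c2E; ring.
Qed.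

End RealIsometries.

Section IntegralIsometries.
Variables (R : realType) (K : K0P 3).
Implicit Types (E F : K) (z : int * int).

Lemma Isom_e_twist f : Isom_e R K f -> forall E, f (E * twist K 1) = f E * twist K 1.
Proof.
move=> [[fD _ _] /connected_component_sub fI].
have mulD : {morph (fun E => E * twist K 1) : E F / E + F}.
  by move=> E F; exact: mulrDl.
apply: (@tensR_inj R _ K (f \o (fun E => E * twist K 1)) ((fun E => E * twist K 1) \o f)).
- by move=> E F; rewrite /= mulD fD.
- by move=> E F; rewrite /= fD mulD.
- rewrite (tensR_comp R (fun E => E * twist K 1) fD) (tensR_comp R f mulD).
  exact: (IsomR_comm_twist1 fI).
Qed.

Lemma Isom_e_mulr f : Isom_e R K f -> forall E, f E = E * f 1.
Proof.
move=> fe E; have [[fD _ _] _] := fe.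
rewrite [in LHS](twist_span E) (morphD_sumz _ _ fD) [in RHS](twist_span E) mulr_suml.
apply: eq_bigr => i _; rewrite mulrzAl; congr (_ *~ _); rewrite (twistX K i).
elim: (nat_of_ord i) => [|k IH]; first by rewrite expr0 mul1r.
by rewrite exprSr Isom_e_twist // IH mulrAC.
Qed.

Lemma elt_unit c1 c2 c3 : 2 * c2 = c1 * (c1 - 1) ->
  elt K 1 c1 c2 c3 * elt K 1 (- c1) (c1 + c2) (- c1 - 2 * c2 - c3) = 1.
Proof. by move=> c2E; rewrite eltM -elt1; congr elt; rewrite ?c2E; lia. Qed.

Lemma Isom_eP f : Isom_e R K f <->
  exists c1 c2 c3, 2 * c2 = c1 * (c1 - 1) /\ f = (fun E => E * elt K 1 c1 c2 c3).
Proof.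
split=> [fe|[c1 [c2 [c3 [c2E ->]]]]]; last first.
  have eu := elt_unit c3 c2E.
  split; last exact: mulmat_elt_IsomR_e.
  split=> [E F||E F]; [exact: mulrDl | | exact: chi_mul_elt].
  exists (fun E => E * elt K 1 (- c1) (c1 + c2) (- c1 - 2 * c2 - c3)) => E.
    by rewrite -mulrA eu mulr1.
  by rewrite -mulrA [X in _ * X]mulrC eu mulr1.
have fE := Isom_e_mulr fe; have [[_ _ fchi] /IsomR_e_rank frk] := fe.
have [c0 [c1 [c2 [c3 f1]]]] := elt_surj (f 1).
have c0E : c0 = 1.
  apply: (@intr_inj R); rewrite [RHS]mulr1z -[RHS]frk.
  rewrite -[in LHS](sum_coord_elt K c0 c1 c2 c3) -f1 rmorph_sum.
  by apply: eq_bigr => i _; rewrite mxE /= twist0.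
rewrite {}c0E in f1; exists c1, c2, c3; split; last first.
  by apply/funext => E; rewrite fE f1.
have := fchi 1 1; rewrite f1 -elt1 !chi_elt; lia.
Qed.

Definition twist_act z E : K := E * (twist K z.1 * (1 + O_lin K 0 *~ z.2)).

Lemma twist_act_elt z E :
  twist_act z E = E * elt K 1 z.1 (binz z.1 2) (binz z.1 3 + z.2).
Proof.
rewrite /twist_act O_point hclass3_elt twist_elt -elt1 eltMz eltD eltM.
by congr (_ * elt _ _ _ _ _); ring.
Qed.

Lemma twist_actD z1 z2 : twist_act (z1 + z2) = twist_act z1 \o twist_act z2.
Proof.
apply/funext => E; rewrite /twist_act /= -twistM mulrzDr -!mulrA; congr (_ * _).
have O2 : O_lin K 0 * O_lin K 0 = 0 by rewrite O_point hclass3_elt eltM -elt0.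
set a := twist K z1.1; set b := twist K z2.1; move: O2; set x := O_lin K 0 => O2.
have -> : 1 + (x *~ z1.2 + x *~ z2.2) = (1 + x *~ z1.2) * (1 + x *~ z2.2).
  rewrite mulrDl mul1r mulrDr mulr1 mulrzAl mulrzAr O2 !mul0rz addr0.
  by rewrite -addrA [X in 1 + X]addrC.
by move: (1 + x *~ z1.2) (1 + x *~ z2.2) => u v; ring.
Qed.

Lemma twist_act0 : twist_act 0 = id.
Proof. by apply/funext => E; rewrite /twist_act mulr0z addr0 mulr1 twist0 mulr1. Qed.

Lemma twist_actK z : cancel (twist_act z) (twist_act (- z)).
Proof.
move=> E; rewrite -[LHS]/((twist_act (- z) \o twist_act z) E).
by rewrite -twist_actD addNr twist_act0.
Qed.

Lemma twist_act_bij : set_bij setT (Isom_e R K) twist_act.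
Proof.
split=> [z _|z1 z2 _ _ eqz|f /Isom_eP[c1 [c2 [c3 [c2E ->]]]]].
- apply/Isom_eP; exists z.1, (binz z.1 2), (binz z.1 3 + z.2).
  by split; [exact: Model.binz2 | apply/funext => E; exact: twist_act_elt].
- have := congr1 (fun f => f 1) eqz; rewrite /= !twist_act_elt !mul1r => /elt_inj[_ e1 _].
  by rewrite e1 => /addrI e2; rewrite (surjective_pairing z1) e1 e2 -surjective_pairing.
- exists (c1, c3 - binz c1 3) => //; apply/funext => E; rewrite twist_act_elt /=.
  rewrite (_ : binz c1 2 = c2) ?[binz _ _ + _]addrC ?subrK //.
  by apply: (mulfI (_ : 2 != 0 :> int)); rewrite ?c2E ?Model.binz2.
Qed.

Lemma Isom_e_transf_group : transf_group (Isom_e R K).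
Proof.
have [act_in _ act_onto] := twist_act_bij.
split=> [f [[]] //||f g /act_onto[y _ <-] /act_onto[z _ <-]|].
- by rewrite -twist_act0; exact: act_in.
- by rewrite -twist_actD; exact: act_in.
- move=> f g /act_onto[z _ <-] _ gK.
  suff -> : g = twist_act (- z) by exact: act_in.
  by apply/funext => E; rewrite -[in RHS](gK E) twist_actK.
Qed.

Lemma transf_group_twist_act (G : set (K -> K)) z :
  transf_group G -> G (twist_act z) -> forall k : int, G (twist_act (z *~ k)).
Proof.
move=> [_ Gid Gcomp Ginv] Gz.
have Gn (n : nat) : G (twist_act (z *+ n)).
  elim: n => [|n IH]; first by rewrite mulr0n twist_act0.
  by rewrite mulrS twist_actD; exact: Gcomp.
case=> n; first exact: Gn.
rewrite NegzE mulrNz; apply: (Ginv (twist_act (z *+ n.+1))) => //; first exact: twist_actK.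
by move=> E; have := twist_actK (- (z *+ n.+1)) E; rewrite opprK.
Qed.

End IntegralIsometries.

Theorem proposition10 (R : realType) (K : K0P 3) :
  transf_isog (int * int)%type (Isom_e R K) /\
  Isom_e R K =
    generated [set (fun E : K => E * twist K 1);
                   (fun E : K => E * (twist K 0 + O_lin K 0))].
Proof.
split; first by exists (@twist_act K); split; [exact: twist_act_bij | exact: twist_actD].
have tE : (fun E : K => E * twist K 1) = twist_act (1, 0).
  by apply/funext => E; rewrite /twist_act mulr0z addr0 mulr1.
have oE : (fun E : K => E * (twist K 0 + O_lin K 0)) = twist_act (0, 1).
  by apply/funext => E; rewrite /twist_act mulr1z twist0 mul1r.
rewrite tE oE; have [act_in _ act_onto] := twist_act_bij R K.
apply/seteqP; split=> [f /act_onto[[k m] _ <-] G [Ggrp SG]|f].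
  have -> : (k, m) = (1, 0) *~ k + (0, 1) *~ m :> (int * int)%type.
    rewrite [RHS]surjective_pairing !raddfD !raddfMz /= !mul0rz addr0 add0r.
    by rewrite !intz.
  have [_ _ Gcomp _] := Ggrp.
  by rewrite twist_actD; apply: Gcomp; apply: transf_group_twist_act => //;
    apply: SG; [left | right].
apply; split; first exact: Isom_e_transf_group.
by move=> _ [->|->]; exact: act_in.
Qed.
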